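(* For every $n\geq 0$, $$w_{3n}=\sum_{k=0}^n\binom{4n-2k}{n+k}\binom{2n+2k}{3k}\frac{t^{n-2k}}{3k+1},$$ $$w_{3n+1}=\sum_{k=0}^n\binom{4n+2-2k}{n+k}\binom{2n+2k}{3k}\frac{t^{n+1-2k}}{2n+1-k},$$ $$w_{3n+2}=\sum_{k=0}^n\binom{4n+2-2k}{n+1+k}\binom{2n+2+2k}{3k+1}\frac{t^{n-2k}}{3k+2}.$$
   Context: For $n\geq 0$ let $P_n$ be a strictly convex polygon with $n+2$ vertices and a marked boundary edge $e_*$. A triangulation of $P_n$ is a decomposition into $n$ non-overlapping triangles with vertices among those of $P_n$. For $n\geq1$, its checkerboard colouring colours each triangle black or white such that the unique triangle containing $e_*$ is black and triangles sharing an edge have different colours; $n_b(\tau),n_w(\tau)$ denote the numbers of black and white triangles of $\tau$. Define the Laurent polynomial $w_n=w_n(t)=\sum_{\tau}t^{n_b(\tau)-n_w(\tau)}$, the sum over all triangulations $\tau$ of $P_n$, with $w_0=1$. *)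

(* Defs.v *)
From mathcomp Require Import all_boot all_order all_algebra.
From mathcomp Require Import boolp classical_sets reals topology normedtype.

Set Implicit Arguments.
Unset Strict Implicit.
Unset Printing Implicit Defensive.

Import Order.TTheory GRing.Theory Num.Theory.
Import numFieldNormedType.Exports.

Local Open Scope ring_scope.

(* Twice the signed area of the triangle a b c: positive iff c lies strictly
   to the left of the line directed from a to b. *)
Definition orient (R : realType) (a b c : 'rV[R]_2) : R :=
  (b 0 0 - a 0 0) * (c 0 1 - a 0 1) - (b 0 1 - a 0 1) * (c 0 0 - a 0 0).

(* P lists the vertices of a strictly convex polygon counterclockwise: the line
   through any boundary edge leaves all the other vertices strictly on its left
   (ordS is the cyclic successor).  The condition is void for two vertices. *)
Definition strictly_convex (R : realType) (m : nat) (P : 'I_m -> 'rV[R]_2) :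
    Prop :=
  forall i j : 'I_m, j != i -> j != ordS i -> 0 < orient (P i) (P (ordS i)) (P j).

Definition hull (R : realType) (m : nat) (P : 'I_m -> 'rV[R]_2)
    (A : {set 'I_m}) : set 'rV[R]_2 :=
  [set p : 'rV[R]_2 | exists a : 'I_m -> R,
    [/\ forall i, 0 <= a i, \sum_(i in A) a i = 1
      & p = \sum_(i in A) a i *: P i]]%classic.

(* A triangle is given by the set of its three vertices; the region it occupies
   is the hull of that set. *)
Definition is_triangulation (R : realType) (n : nat)
    (P : 'I_n.+2 -> 'rV[R]_2) (tau : {set {set 'I_n.+2}}) : Prop :=
  [/\ #|tau| = n,
      forall T : {set 'I_n.+2}, T \in tau -> #|T| = 3%N,
      forall T T' : {set 'I_n.+2}, T \in tau -> T' \in tau -> T != T' ->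
        (interior (hull P T) `&` interior (hull P T') = set0)%classic
    & (\bigcup_(T in [set` tau]) hull P T)%classic = hull P (finset.setT : {set 'I_n.+2})].

(* The labelling of the vertices starts at an end of the marked edge, which is
   thus the edge from the last vertex back to the first. *)
Definition marked_edge (n : nat) : {set 'I_n.+2} := [set ord_max; ord0].

(* B is the set of black triangles of a checkerboard colouring of tau. *)
Definition is_checkerboard (n : nat) (tau B : {set {set 'I_n.+2}}) : bool :=
  [&& B \subset tau,
      [forall T in tau, (marked_edge n \subset T) ==> (T \in B)]
    & [forall T in tau, forall T' in tau,
        (#|T :&: T'| == 2%N) ==> ((T \in B) != (T' \in B))]].

(* A triangulation has exactly one checkerboard colouring; set0 is a dummy value
   for the other sets of triangles. *)
Definition black (n : nat) (tau : {set {set 'I_n.+2}}) : {set {set 'I_n.+2}} :=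
  odflt finset.set0 [pick B | is_checkerboard tau B].

Definition n_b (n : nat) (tau : {set {set 'I_n.+2}}) : nat := #|black tau|.

Definition n_w (n : nat) (tau : {set {set 'I_n.+2}}) : nat :=
  #|tau :\: black tau|.

(* Laurent polynomials in t are handled inside the field Q(t), which contains
   the ring Q[t, t^-1]. *)
Definition ratfun := {fraction {poly rat}}.

Definition t : ratfun := tofrac 'X.

(* For n = 0 the polygon degenerates to a segment and the value is a convention. *)
Definition w (R : realType) (n : nat) (P : 'I_n.+2 -> 'rV[R]_2) : ratfun :=
  if n == 0%N then 1
  else \sum_(tau : {set {set 'I_n.+2}} | `[< is_triangulation P tau >])
         t ^ ((n_b tau)%:Z - (n_w tau)%:Z).

(* Main.v *)
Require Import Defs.
From mathcomp Require Import boolp classical_sets reals topology normedtype.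
From mathcomp Require Import all_boot all_order all_algebra.
From mathcomp Require Import ring lra zify.

Set Implicit Arguments.
Unset Strict Implicit.
Unset Printing Implicit Defensive.

Import Order.TTheory GRing.Theory Num.Theory.
Import numFieldNormedType.Exports.
Local Open Scope ring_scope.

(* Removing the triangle at the marked edge leaves two smaller triangulated
   polygons with the colours exchanged.  Hence the generating functions
   W = sum_n w_n(t) x^n and V = sum_n w_n(1/t) x^n satisfy W = 1 + x t V^2 and
   V = 1 + (x/t) W^2.  Lagrange-Good inversion gives the coefficients of
   W^r V^s; conversely, these satisfy a Pascal rule coming from
   W^(r+1) = W^r + x t W^r V^2 and its mirror image, and this rule forces the
   product formula (W^r V^s) (W^r' V^s') = W^(r+r') V^(s+s') and with it the
   recurrence of the w_n.
     The geometric notion of triangulation is equivalent to a combinatorial one: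
   n pairwise non-crossing 3-sets of vertices.  Two triangles with properly
   crossing sides overlap near the crossing point; two non-crossing ones are
   separated by a side of the first; and the cover of the polygon is obtained by
   cutting along the triangle at the marked edge.  That this triangle exists
   follows by counting: a non-crossing family without it has fewer than n
   members. *)

(** * Integer coefficients of W^r V^s *)

(* The coefficient of y^b z^w in W^r V^s, where W = 1 + y V^2 and V = 1 + z W^2,
   given by Lagrange-Good inversion.  The second term is dropped for b = 0 or
   w = 0, where the truncated predecessors would make it nonzero. *)
Definition gcoef (r s b w : nat) : int :=
  'C(2 * w + r, b)%:Z * 'C(2 * b + s, w)%:Z -
  (if (b == 0%N) || (w == 0%N) then 0
   else 4 * 'C((2 * w + r).-1, b.-1)%:Z * 'C((2 * b + s).-1, w.-1)%:Z).

Lemma gcoefC r s b w : gcoef r s b w = gcoef s r w b.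
Proof. by rewrite /gcoef orbC; case: ifP => _; ring. Qed.

Lemma gcoef0l r s w : gcoef r s 0 w = 'C(s, w)%:Z.
Proof. by rewrite /gcoef eqxx orTb muln0 add0n bin0 mul1r subr0. Qed.

Lemma gcoef0r r s b : gcoef r s b 0 = 'C(r, b)%:Z.
Proof. by rewrite gcoefC gcoef0l. Qed.

Lemma gcoefSS r s b w : gcoef r s b.+1 w.+1 =
  'C((2 * w + r).+2, b.+1)%:Z * 'C((2 * b + s).+2, w.+1)%:Z -
  4 * 'C((2 * w + r).+1, b)%:Z * 'C((2 * b + s).+1, w)%:Z.
Proof. by rewrite /gcoef !mulnS !addSn. Qed.

Lemma gcoefSl0 r s w : gcoef r.+1 s 0 w = gcoef r s 0 w.
Proof. by rewrite !gcoef0l. Qed.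

(** The coefficient form of W^(r+1) = W^r + y W^r V^2. Pascal's rule is applied to the binomials
    whose upper index contains r; the shift from s to s + 2 absorbs the passage from b + 1 to b in
    2b + s. *)
Lemma gcoefSl r s b w :
  gcoef r.+1 s b.+1 w = gcoef r s b.+1 w + gcoef r s.+2 b w.
Proof.
case: w => [|w]; first by rewrite !gcoef0r binS PoszD.
rewrite !gcoefSS addnS binS PoszD.
case: b => [|b]; first by rewrite gcoef0l muln0 add0n !bin0; ring.
rewrite gcoefSS !addnS mulnS !addSn (binS _ b) PoszD; ring.
Qed.

Lemma gcoefSr0 r s b : gcoef r s.+1 b 0 = gcoef r s b 0.
Proof. by rewrite !gcoef0r. Qed.

Lemma gcoefSr r s b w :
  gcoef r s.+1 b w.+1 = gcoef r s b w.+1 + gcoef r.+2 s b w.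
Proof. by rewrite gcoefC gcoefSl gcoefC [gcoef s _ _ _]gcoefC. Qed.

(** Away from the axes the two products cancel: absorption in each binomial pulls out (2w+2)/(b+1)
    and (2b+2)/(w+1), whose product is the constant 4 of [gcoef]. *)
Lemma gcoef00 b w : gcoef 0 0 b w = ((b == 0%N) && (w == 0%N))%:Z.
Proof.
case: b => [|b]; first by rewrite gcoef0l bin0n.
case: w => [|w]; first by rewrite gcoef0r bin0n.
rewrite gcoefSS !addn0.
have := mul_bin_diag (2 * w).+2 b; have := mul_bin_diag (2 * b).+2 w.
rewrite !succnK; set x := 'C(_, w); set y := 'C(_, w.+1) => e1.
set z := 'C(_, b); set v := 'C(_, b.+1) => e2.
apply: (@mulfI _ (w.+1 * b.+1)%:Z) => //; rewrite mulr0.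
have -> : (w.+1 * b.+1)%:Z * (v%:Z * y%:Z - 4 * z%:Z * x%:Z) =
  (b.+1 * v)%:Z * (w.+1 * y)%:Z - 4 * (w.+1 * z)%:Z * (b.+1 * x)%:Z.
  by rewrite !PoszM; ring.
rewrite -e1 -e2; lia.
Qed.

(** For positive [w], absorption turns the two terms of [gcoef] into 2w + 1 and 2w times the same
    product of binomials, so that exactly one copy survives. *)
Lemma mul_gcoef10S b w :
  b.+1%:Z * gcoef 1 0 b.+1 w = 'C(2 * b.+1, w)%:Z * 'C(2 * w, b)%:Z.
Proof.
case: w => [|w].
  by rewrite gcoef0r binS muln0 bin0 !bin0n; case: b => //= b; rewrite mulr0.
rewrite gcoefSS addn0 addn1 !mulnS !add2n.
have := mul_bin_diag (2 * w).+3 b; have := mul_bin_diag (2 * b).+2 w.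
rewrite !succnK.
set x := 'C((2 * b).+1, w); set y := 'C(_, w.+1); move=> e1.
set z := 'C(_, b); set v := 'C(_, b.+1) => e2.
have -> : b.+1%:Z * (v%:Z * y%:Z - 4 * z%:Z * x%:Z) =
   (b.+1 * v)%:Z * y%:Z - 2 * z%:Z * ((2 * b).+2 * x)%:Z by lia.
rewrite e1 -e2; lia.
Qed.

Lemma gcoef10_small b w : (2 * b < w)%N -> gcoef 1 0 b w = 0.
Proof.
case: b => [|b] lt_bw; first by rewrite gcoef0l bin_small; lia.
by have /eqP := mul_gcoef10S b w; rewrite (bin_small lt_bw) mul0r mulf_eq0 => /eqP.
Qed.

Lemma gcoef10_large b w : (2 * w < b)%N -> gcoef 1 0 b.+1 w = 0.
Proof.
move=> lt_wb.
by have /eqP := mul_gcoef10S b w; rewrite (bin_small lt_wb) mulr0 mulf_eq0 => /eqP.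
Qed.

(** A second closed form, obtained by lowering the lower index of ['C(2 * w, b.+1)]. Its denominator
    is the one wanted in the residue classes 0 and 2 modulo 3. *)
Lemma mul_gcoef10 b w : (b <= 2 * w)%N ->
  (2 * w - b).+1%:Z * gcoef 1 0 b w = 'C(2 * b, w)%:Z * 'C(2 * w, b)%:Z.
Proof.
case: b => [|b] le_bw.
  by rewrite gcoef0l muln0 bin0 bin0n; case: w {le_bw} => //= w; rewrite mulr0.
apply: (@mulfI _ b.+1%:Z) => //.
rewrite mulrCA mul_gcoef10S mulrCA [RHS]mulrCA -!PoszM.
by rewrite mul_bin_left -subSn // subSS.
Qed.

(** * Coefficients of x^n in W^r V^s, and the three closed forms *)

Section Coefficients.
Variables (K : fieldType) (t : K) (t_neq0 : t != 0).

Definition ghom (r s n : nat) : K :=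
  \sum_(b < n.+1) (gcoef r s b (n - b))%:~R * t ^ (b%:Z - (n - b)%N%:Z).

Lemma ghom0 r s : ghom r s 0 = 1.
Proof. by rewrite /ghom big_ord1 gcoef0l bin0 mulr1. Qed.

Lemma ghomSl r s n : ghom r.+1 s n.+1 = ghom r s n.+1 + t * ghom r s.+2 n.
Proof.
rewrite /ghom !(big_ord_recl n.+1) gcoefSl0 -!addrA; congr (_ + _).
rewrite mulr_sumr -big_split; apply: eq_bigr => b _ /=.
rewrite /bump /= add1n subSS gcoefSl rmorphD mulrDl; congr (_ + _).
rewrite mulrCA; congr (_ * _).
rewrite -[in RHS](expr1z t) -expfzDr //; congr (_ ^ _); lia.
Qed.

Lemma ghomSr r s n : ghom r s.+1 n.+1 = ghom r s n.+1 + t^-1 * ghom r.+2 s n.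
Proof.
rewrite /ghom !(big_ord_recr n.+1) /= subnn gcoefSr0 addrAC; congr (_ + _).
rewrite mulr_sumr -big_split; apply: eq_bigr => b _ /=.
have le_bn : (b <= n)%N by rewrite -ltnS.
rewrite subSn // gcoefSr rmorphD mulrDl; congr (_ + _).
rewrite mulrCA; congr (_ * _).
rewrite -[t^-1]/(t ^ -1) -expfzDr //; congr (_ ^ _); lia.
Qed.

Lemma ghom00 n : ghom 0 0 n = (n == 0%N)%:R.
Proof.
case: n => [|n]; first by rewrite ghom0.
rewrite /ghom big1 // => b _; rewrite gcoef00.
case: (nat_of_ord b) => [|m] /=; rewrite ?mul0r //.
Qed.

(* [ghom r s n] is the coefficient of x^n in W^r V^s, at y = x t and z = x / t:
   for fixed r' and s', the recurrences and the induction on n make the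
   difference of the two sides independent of r and s. *)
Lemma ghomD n r s r' s' :
  \sum_(i < n.+1) ghom r s i * ghom r' s' (n - i) = ghom (r + r') (s + s') n.
Proof.
elim: n r s r' s' => [|n IHn] r s r' s'; first by rewrite big_ord1 !ghom0 mulr1.
elim: r => [|r IHr].
  elim: s => [|s IHs].
    rewrite big_ord_recl /= ghom0 mul1r subn0 big1 ?addr0 // => i _.
    by rewrite ghom00 mul0r.
  rewrite add0n addSn ghomSr -[r' in ghom r' _ n.+1]add0n -IHs.
  rewrite -[ghom _.+2 _ n](IHn 2%N s r' s') mulr_sumr.
  rewrite !(big_ord_recl n.+1) !ghom0 /= -addrA; congr (_ + _).
  rewrite -big_split; apply: eq_bigr => i _ /=.
  by rewrite /bump /= add1n subSS ghomSr mulrDl mulrA.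
rewrite addSn ghomSl -IHr -[ghom _ _.+2 n](IHn r s.+2 r' s') mulr_sumr.
rewrite !(big_ord_recl n.+1) !ghom0 /= -addrA; congr (_ + _).
rewrite -big_split; apply: eq_bigr => i _ /=.
by rewrite /bump /= add1n subSS ghomSl mulrDl mulrA.
Qed.

(** The coefficient of x^(n+1) in W = 1 + x t V^2, with the square expanded by [ghomD]. *)
Lemma ghom10S n :
  ghom 1 0 n.+1 = t * \sum_(i < n.+1) ghom 0 1 i * ghom 0 1 (n - i).
Proof. by rewrite ghomSl ghom00 add0r ghomD. Qed.

(** The coefficient of y^b z^w in W vanishes for w > 2b and for b > 2w + 1. The last two numerical
    hypotheses say that this covers every b below [lo] and every b above [lo + n]. The remaining
    terms are listed by decreasing b, which gives the index k of the theorem. *)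
Lemma ghom10_window (lo n m : nat) : (lo + n <= m)%N ->
    (3 * lo <= m + 2)%N -> (2 * m <= 3 * (lo + n) + 1)%N ->
  ghom 1 0 m = \sum_(0 <= k < n.+1)
    (gcoef 1 0 (lo + n - k) (m - (lo + n - k)))%:~R *
    t ^ ((lo + n - k)%N%:Z - (m - (lo + n - k))%N%:Z).
Proof.
move=> le_m le_lo ge_hi; rewrite /ghom.
pose F b := (gcoef 1 0 b (m - b))%:~R * t ^ (b%:Z - (m - b)%N%:Z).
rewrite -(big_mkord xpredT F) (big_cat_nat (n := lo)) //=; last lia.
rewrite (big_cat_nat (n := (lo + n).+1) (m := lo)) //=; try lia.
rewrite big_nat big1 ?add0r => [|b /andP[_ lt_b]]; last first.
  by rewrite /F gcoef10_small ?mul0r //; lia.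
rewrite addrC big_nat big1 ?add0r => [|b /andP[lt_b le_b]]; last first.
  by case: b lt_b le_b => // b *; rewrite /F gcoef10_large ?mul0r //; lia.
rewrite -{1}[lo]add0n big_addn (_ : (_ - lo = n.+1)%N); last lia.
rewrite big_nat_rev !big_nat; apply: eq_bigr => k /andP[_ lt_k].
rewrite -/(F _); congr F; lia.
Qed.

Hypothesis natr_neq0 : forall n, n.+1%:R != 0 :> K.

Lemma gcoef10_fracr b w : (b <= 2 * w)%N ->
  (gcoef 1 0 b w)%:~R =
    'C(2 * b, w)%:R * 'C(2 * w, b)%:R / (2 * w - b).+1%:R :> K.
Proof.
move=> /mul_gcoef10 /(congr1 (fun z : int => z%:~R : K)).
rewrite !rmorphM /= -!pmulrn => <-.
by rewrite mulrAC mulfV ?natr_neq0 ?mul1r.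
Qed.

Lemma gcoef10_fracl b w :
  (gcoef 1 0 b.+1 w)%:~R =
    'C(2 * b.+1, w)%:R * 'C(2 * w, b)%:R / b.+1%:R :> K.
Proof.
have /(congr1 (fun z : int => z%:~R : K)) := mul_gcoef10S b w.
rewrite !rmorphM /= -!pmulrn => <-.
by rewrite mulrAC mulfV ?natr_neq0 ?mul1r.
Qed.

Lemma ghom10_mod0 n : ghom 1 0 (3 * n) = \sum_(0 <= k < n.+1)
  'C(4 * n - 2 * k, n + k)%:R * 'C(2 * n + 2 * k, 3 * k)%:R *
  (t ^ (n%:Z - (2 * k)%N%:Z) / (3 * k + 1)%N%:R).
Proof.
rewrite (@ghom10_window n n); [|lia..].
rewrite !big_nat; apply: eq_bigr => k /andP[_ lt_k].
have -> : (3 * n - (n + n - k) = n + k)%N by lia.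
rewrite gcoef10_fracr; last lia.
rewrite mulrAC -mulrA; congr (_%:R * _%:R * (_ ^ _ / _%:R)).
- congr 'C(_, _); lia.
(* Symmetry of the binomial replaces the lower index 2n - k by 3k. *)
- by rewrite -bin_sub; [congr 'C(_, _); lia|lia].
- lia.
- lia.
Qed.

Lemma ghom10_mod1 n : ghom 1 0 (3 * n + 1) = \sum_(0 <= k < n.+1)
  'C(4 * n + 2 - 2 * k, n + k)%:R * 'C(2 * n + 2 * k, 3 * k)%:R *
  (t ^ ((n + 1)%N%:Z - (2 * k)%N%:Z) / (2 * n + 1 - k)%N%:R).
Proof.
rewrite (@ghom10_window n.+1 n); [|lia..].
rewrite !big_nat; apply: eq_bigr => k /andP[_ lt_k].
have -> : (3 * n + 1 - (n.+1 + n - k) = n + k)%N by lia.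
have -> : (n.+1 + n - k = (n + n - k).+1)%N by lia.
(* Here k = 0 gives b = 2w + 1, outside the range of [gcoef10_fracr]; hence the form with
   denominator b = 2n + 1 - k. *)
rewrite gcoef10_fracl mulrAC -mulrA; congr (_%:R * _%:R * (_ ^ _ / _%:R)).
- congr 'C(_, _); lia.
- by rewrite -bin_sub; [congr 'C(_, _); lia|lia].
- lia.
- lia.
Qed.

Lemma ghom10_mod2 n : ghom 1 0 (3 * n + 2) = \sum_(0 <= k < n.+1)
  'C(4 * n + 2 - 2 * k, n + 1 + k)%:R *
  'C(2 * n + 2 + 2 * k, 3 * k + 1)%:R *
  (t ^ (n%:Z - (2 * k)%N%:Z) / (3 * k + 2)%N%:R).
Proof.
rewrite (@ghom10_window n.+1 n); [|lia..].
rewrite !big_nat; apply: eq_bigr => k /andP[_ lt_k].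
have -> : (3 * n + 2 - (n.+1 + n - k) = n + 1 + k)%N by lia.
rewrite gcoef10_fracr; last lia.
rewrite mulrAC -mulrA; congr (_%:R * _%:R * (_ ^ _ / _%:R)).
- congr 'C(_, _); lia.
- by rewrite -bin_sub; [congr 'C(_, _); lia|lia].
- lia.
- lia.
Qed.

End Coefficients.

(** * Non-crossing families of triangles on labelled vertices *)

Section NoncrossingTriangles.
Local Open Scope nat_scope.
Variable N : nat.
Implicit Types (a b i j x y z u v : 'I_N) (T : {set 'I_N}).
Implicit Types (tau B : {set {set 'I_N}}).

(** The vertices of the subpolygon cut off by the chord from [a] to [b], which serves as its marked
    edge. *)
Definition itv a b : {set 'I_N} := [set x : 'I_N | a <= x <= b].

Lemma itvP a b T : reflect (forall x, x \in T -> a <= x <= b) (T \subset itv a b).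
Proof.
apply: (iffP subsetP) => sTab x /sTab; first by rewrite inE.
by rewrite inE.
Qed.

(** This fails exactly when a side xy of [T] and a side uv of [T'] cross properly, which the cyclic
    order of the labels detects. *)
Definition noncrossing T T' : bool :=
  [forall x in T, forall y in T, forall u in T', forall v in T',
     (x < u < y) ==> (x <= v <= y)].

Lemma noncrossingP T T' :
  reflect (forall x y u v, x \in T -> y \in T -> u \in T' -> v \in T' ->
             x < u < y -> x <= v <= y)
          (noncrossing T T').
Proof.
apply: (iffP forall_inP) => [nc x y u v Tx Ty T'u T'v|nc x Tx].
  by move: (nc x Tx) => /forall_inP/(_ y Ty)/forall_inP/(_ u T'u)/forall_inP/(_ v T'v)/implyP.
apply/forall_inP => y Ty; apply/forall_inP => u T'u; apply/forall_inP => v T'v.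
by apply/implyP; apply: nc.
Qed.

Lemma set3E x y z T : x \in T -> y \in T -> z \in T -> x < y -> y < z ->
  #|T| = 3 -> T = [set x; y; z].
Proof.
move=> Tx Ty Tz lt_xy lt_yz T3; apply/esym/eqP.
rewrite eqEcard -setUA !subUset !sub1set Tx Ty Tz T3 /= setUA.
rewrite -setUA !cardsU1 cards1 !inE -!val_eqE /=.
by case: eqP; case: eqP; case: eqP => //; lia.
Qed.

Lemma card3_sorted T : #|T| = 3 ->
  exists x y z, [/\ x < y, y < z & T = [set x; y; z]].
Proof.
move=> T3; have /card_gt2P[x [y [z [[Tx Ty Tz] []]]]] : 2 < #|T| by rewrite T3.
rewrite -!val_eqE /= => xy yz zx.
have sorted x' y' z' : x' \in T -> y' \in T -> z' \in T -> x' < y' -> y' < z' ->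
    exists x y z, [/\ x < y, y < z & T = [set x; y; z]].
  by move=> *; exists x', y', z'; split=> //; apply: set3E.
case: (ltngtP x y) xy => // xy _; case: (ltngtP y z) yz => // yz _;
  case: (ltngtP z x) zx => // zx _; try lia.
- exact: (sorted x y z).
- exact: (sorted z x y).
- exact: (sorted x z y).
- exact: (sorted y z x).
- exact: (sorted y x z).
- exact: (sorted z y x).
Qed.

Lemma card_set3 x y z : x < y -> y < z -> #|[set x; y; z]| = 3.
Proof.
move=> lt_xy lt_yz; rewrite -setUA !cardsU1 cards1 !inE -!val_eqE /=.
by case: eqP; case: eqP; case: eqP => //; lia.
Qed.

Lemma card_itv3 a b T : #|T| = 3 -> T \subset itv a b -> a.+1 < b.
Proof.
move=> /card3_sorted[x [y [z [xy yz ->]]]] /itvP sT.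
have := sT x; have := sT z; rewrite !inE !eqxx !orbT /= => /(_ isT) + /(_ isT).
lia.
Qed.

Definition noncrossing_family a b tau : bool :=
  [forall T in tau, (#|T| == 3) && (T \subset itv a b)] &&
  [forall T in tau, forall T' in tau, (T != T') ==> noncrossing T T'].

Lemma noncrossing_familyP a b tau :
  reflect [/\ forall T, T \in tau -> #|T| = 3,
              forall T, T \in tau -> T \subset itv a b
            & forall T T', T \in tau -> T' \in tau -> T != T' -> noncrossing T T']
          (noncrossing_family a b tau).
Proof.
apply: (iffP andP) => [[/forall_inP t3 /forall_inP nc]|[t3 tab nc]].
  split=> [T /t3/andP[/eqP]//|T /t3/andP[]//|T T' /nc/forall_inP h /h /implyP].
  by [].
split; first by apply/forall_inP => T tT; rewrite t3 ?tab.
by apply/forall_inP => T tT; apply/forall_inP => T' tT'; apply/implyP/nc.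
Qed.

Lemma noncrossing_family_sub a b i j tau :
  noncrossing_family a b tau -> noncrossing_family i j (tau ::&: itv i j).
Proof.
move=> /noncrossing_familyP[t3 tab nc]; apply/noncrossing_familyP.
split=> [T|T|T T']; rewrite !inE => /andP[tT ijT] //; first exact: t3.
by move=> /andP[tT' _]; apply: nc.
Qed.

(** A vertex of [T] strictly between [a] and [i], or between [i] and [b], confines all of [T] to
    that range. Without such a vertex [T] has only [a], [i], [b] available and would equal [T0]. *)
Lemma noncrossing_edge a i b T T0 : noncrossing T0 T -> #|T| = 3 -> #|T0| = 3 ->
  a \in T0 -> i \in T0 -> b \in T0 -> T \subset itv a b -> T0 != T ->
  (T \subset itv a i) || (T \subset itv i b).
Proof.
move=> /noncrossingP nc T3 T03 T0a T0i T0b /itvP Tab neqT.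
case: (boolP [exists u in T, a < u < i]) => [/exists_inP[u Tu aui]|/exists_inPn noai].
  by apply/orP; left; apply/itvP => v Tv; apply: (nc a i u v).
case: (boolP [exists u in T, i < u < b]) => [/exists_inP[u Tu iub]|/exists_inPn noib].
  by apply/orP; right; apply/itvP => v Tv; apply: (nc i b u v).
case/negP: neqT; rewrite eq_sym eqEcard T3 T03 andbT; apply/subsetP => u Tu.
have := Tab u Tu; have := noai u Tu; have := noib u Tu => h1 h2 h3.
have [->//|ua] := eqVneq u a; have [->//|ui] := eqVneq u i.
have [->//|ub] := eqVneq u b.
move: ua ui ub; rewrite -!val_eqE /=; lia.
Qed.

(** Induction on b - a. A triangle {a, i, b} splits the others between [itv a i] and [itv i b], and
    (i-a-1) + (b-i-1) + 1 = b-a-1. When there is none, some chord from [a] still splits the family,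
    or no triangle has [a] as a vertex; both cases lose at least one triangle. *)
Lemma card_noncrossing_family a b tau : noncrossing_family a b tau ->
  #|tau| <= (b - a).-1 /\
  (#|tau| = (b - a).-1 -> a.+1 < b ->
     exists i, [/\ a < i, i < b & [set a; i; b] \in tau]).
Proof.
have [m] := ubnP (b - a); elim: m => // m IHm in a b tau *.
rewrite ltnS => le_m nctau; have [t3 tab nc] := noncrossing_familyP _ _ _ nctau.
have [->|/set0Pn[T1 tT1]] := eqVneq tau set0.
  by rewrite cards0; split=> // e; lia.
have lt_ab := card_itv3 (t3 _ tT1) (tab _ tT1).
have bound i j : j - i < m -> #|tau ::&: itv i j| <= (j - i).-1.
  by move=> lt_m; have [] := IHm i j _ lt_m (noncrossing_family_sub _ _ nctau).
case: (boolP [exists i : 'I_N, (a < i < b) && ([set a; i; b] \in tau)]).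
  case/existsP=> i /andP[/andP[lt_ai lt_ib] tT0]; split; last by exists i.
  have sub : tau \subset [set a; i; b] |: (tau ::&: itv a i :|: tau ::&: itv i b).
    apply/subsetP => T tT; rewrite !inE tT /= eq_sym.
    case: eqVneq => //= neqT.
    by apply: noncrossing_edge (nc _ _ tT0 tT neqT) _ _ _ _ _ _ neqT;
      rewrite ?t3 ?tab // !inE eqxx ?orbT.
  apply: leq_trans (subset_leq_card sub) _; rewrite cardsU1.
  have := bound a i ltac:(lia); have := bound i b ltac:(lia).
  have := (leq_card_setU (tau ::&: itv a i) (tau ::&: itv i b)).1.
  by move: lt_ai lt_ib; clear; case: (_ \in _); lia.
move=> /existsPn noT0.
suff : #|tau| < (b - a).-1 by lia.
have noab T : T \in tau -> a \in T -> b \notin T.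
  move=> tT Ta; apply/negP => Tb.
  have [x [y [z [xy yz eT]]]] := card3_sorted (t3 _ tT).
  have /itvP sT := tab _ tT.
  have := sT x; have := sT z; rewrite eT !inE !eqxx !orbT /= => /(_ isT) zab /(_ isT) xab.
  move: Ta Tb; rewrite eT !inE -!val_eqE /= => Ta Tb.
  have ax : a = x by apply: val_inj => /=; lia.
  have bz : b = z by apply: val_inj => /=; lia.
  by have := noT0 y; rewrite ax bz xy yz -eT tT.
pose meets i := [exists T in tau, (a \in T) && (i \in T)].
case: (boolP (meets a)) => [ma|nma]; last first.
  have ltN : a.+1 < N by apply: leq_trans (ltn_ord b); lia.
  have -> : tau = tau ::&: itv (Ordinal ltN) b.
    apply/setP => T; rewrite !inE; case tT : (T \in tau) => //=.
    apply/esym/itvP => x Tx /=; have /itvP/(_ x Tx) := tab _ tT.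
    have : x != a.
      apply: contra nma => /eqP ea; apply/exists_inP; exists T => //.
      by rewrite -ea Tx.
    rewrite -val_eqE /=; lia.
  have := bound (Ordinal ltN) b => /=; lia.
(* Let [i] be the farthest vertex sharing a triangle [T2] with [a]. Triangles at [a] stay below [i]
   by maximality, and the others cannot cross the side of [T2] from [a] to [i]. *)
have [i mi max_i] := arg_maxnP (fun i : 'I_N => nat_of_ord i) ma.
have [T2 tT2 /andP[T2a T2i]] := exists_inP mi.
have le_i T x : T \in tau -> a \in T -> x \in T -> x <= i.
  by move=> tT Ta Tx; apply: max_i; apply/exists_inP; exists T => //; rewrite Ta.
have lt_ai : a.+1 < i.
  apply: (card_itv3 (t3 _ tT2)); apply/itvP => x T2x.
  by have /itvP/(_ x T2x)/andP[-> _] := tab _ tT2; apply: le_i T2x.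
have lt_ib : i < b.
  have /itvP/(_ i T2i)/andP[_] := tab _ tT2; rewrite leq_eqVlt => /orP[/eqP/val_inj eib|//].
  by have := noab _ tT2 T2a; rewrite -eib T2i.
have sub : tau \subset tau ::&: itv a i :|: tau ::&: itv i b.
  apply/subsetP => T tT; rewrite !inE tT /=; have /itvP sT := tab _ tT.
  case: (boolP (a \in T)) => [Ta|nTa].
    apply/orP; left; apply/itvP => x Tx.
    by have /andP[-> _] := sT x Tx; apply: le_i Tx.
  have neqT : T2 != T by apply: contraNneq nTa => <-.
  have /noncrossingP ncT := nc _ _ tT2 tT neqT.
  case: (boolP [exists u in T, a < u < i]) => [/exists_inP[u Tu aui]|/exists_inPn noai].
    by apply/orP; left; apply/itvP => v Tv; apply: (ncT a i u v).
  apply/orP; right; apply/itvP => v Tv; have := noai v Tv; have := sT v Tv.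
  have : v != a by apply: contraNneq nTa => <-.
  by rewrite -val_eqE /=; clear; lia.
have := (leq_card_setU (tau ::&: itv a i) (tau ::&: itv i b)).1.
move: (subset_leq_card sub) (bound a i) (bound i b) le_m lt_ai lt_ib.
by clear; lia.
Qed.

(** By [card_noncrossing_family] these are the non-crossing families that attain the upper bound on
    the size; no condition of covering is imposed. *)
Definition triangulation a b tau : bool :=
  (#|tau| == (b - a).-1) && noncrossing_family a b tau.

Definition glue a i b tau1 tau2 := [set a; i; b] |: (tau1 :|: tau2).

(** The two subfamilies satisfy the bounds i-a-1 and b-i-1, and the size of [tau] leaves no room for
    a strict inequality in either. *)
Lemma triangulation_split a i b tau : a < i -> i < b ->
  triangulation a b tau -> [set a; i; b] \in tau ->
  [/\ triangulation a i (tau ::&: itv a i), triangulation i b (tau ::&: itv i b)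
    & tau = glue a i b (tau ::&: itv a i) (tau ::&: itv i b)].
Proof.
move=> lt_ai lt_ib /andP[/eqP card_tau nctau] tT0.
have [t3 tab nc] := noncrossing_familyP _ _ _ nctau.
have etau : tau = glue a i b (tau ::&: itv a i) (tau ::&: itv i b).
  apply/setP => T; rewrite !inE eq_sym.
  case: eqVneq => [<-//|neqT] /=; rewrite -andb_orr.
  case tT : (T \in tau) => //=; apply/esym.
  by apply: noncrossing_edge (nc _ _ tT0 tT neqT) _ _ _ _ _ _ neqT;
      rewrite ?t3 ?tab // !inE eqxx ?orbT.
rewrite /triangulation !(noncrossing_family_sub _ _ nctau) !andbT.
suff [-> ->] : #|tau ::&: itv a i| = (i - a).-1 /\ #|tau ::&: itv i b| = (b - i).-1.
  by rewrite !eqxx.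
have [+ _] := card_noncrossing_family (noncrossing_family_sub a i nctau).
have [+ _] := card_noncrossing_family (noncrossing_family_sub i b nctau).
have := (leq_card_setU (tau ::&: itv a i) (tau ::&: itv i b)).1.
move: card_tau; rewrite {1}etau cardsU1; case: (_ \notin _); lia.
Qed.

Lemma triangulation_glue a i b tau1 tau2 : a < i -> i < b ->
  triangulation a i tau1 -> triangulation i b tau2 ->
  [/\ triangulation a b (glue a i b tau1 tau2),
      glue a i b tau1 tau2 ::&: itv a i = tau1
    & glue a i b tau1 tau2 ::&: itv i b = tau2].
Proof.
move=> lt_ai lt_ib /andP[/eqP card1 nc1] /andP[/eqP card2 nc2].
have [t31 tai nc1'] := noncrossing_familyP _ _ _ nc1.
have [t32 tib nc2'] := noncrossing_familyP _ _ _ nc2.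
have t3 T : T \in glue a i b tau1 tau2 -> #|T| = 3.
  rewrite !inE => /orP[/eqP->|/orP[/t31//|/t32//]]; exact: card_set3.
(* A common triangle would have [i] as its only possible vertex. *)
have disj T : T \in tau1 -> T \in tau2 -> False.
  move=> tT1 tT2; suff /(card_itv3 (t31 _ tT1)) : T \subset itv i i by lia.
  apply/itvP => x Tx.
  have /itvP/(_ x Tx) := tai _ tT1; have /itvP/(_ x Tx) := tib _ tT2; lia.
have T0b : ~~ ([set a; i; b] \subset itv a i).
  by apply/negP => /itvP/(_ b); rewrite !inE eqxx orbT => /(_ isT); lia.
have T0a : ~~ ([set a; i; b] \subset itv i b).
  by apply/negP => /itvP/(_ a); rewrite !inE eqxx => /(_ isT); lia.
split.
- apply/andP; split.
    rewrite cardsU1 cardsU !inE.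
    have -> : tau1 :&: tau2 = set0.
      by apply/setP => T; rewrite !inE; apply/andP => -[]; apply: disj.
    rewrite (contraNF (@tai _)) // (contraNF (@tib _)) // cards0 card1 card2; lia.
  have T0P x : x \in [set a; i; b] -> [\/ x = a :> nat, x = i :> nat | x = b :> nat].
    by rewrite !inE => /orP[/orP[]|] /eqP->; [constructor 1|constructor 2|constructor 3].
  apply/noncrossing_familyP; split=> // [T|T T'].
    rewrite !inE => tT; apply/itvP => x; move: tT.
    move=> /orP[/eqP->/T0P|/orP[/tai|/tib]].
    - by case=> ->; lia.
    - by move=> /itvP sT /sT; lia.
    - by move=> /itvP sT /sT; lia.
  rewrite !inE => /orP[/eqP->|/orP[tT|tT]] /orP[/eqP->|/orP[tT'|tT']] neqT.
  + by rewrite eqxx in neqT.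
  + apply/noncrossingP => x y u v /T0P Tx /T0P Ty.
    move=> /(itvP _ _ _ (tai _ tT')) + /(itvP _ _ _ (tai _ tT')).
    by case: Tx => ->; case: Ty => ->; lia.
  + apply/noncrossingP => x y u v /T0P Tx /T0P Ty.
    move=> /(itvP _ _ _ (tib _ tT')) + /(itvP _ _ _ (tib _ tT')).
    by case: Tx => ->; case: Ty => ->; lia.
  + apply/noncrossingP => x y u v /(itvP _ _ _ (tai _ tT)) + /(itvP _ _ _ (tai _ tT)).
    by move=> + + /T0P Tu _; case: Tu => ->; lia.
  + by apply: nc1' neqT.
  + apply/noncrossingP => x y u v /(itvP _ _ _ (tai _ tT)) + /(itvP _ _ _ (tai _ tT)).
    by move=> + + /(itvP _ _ _ (tib _ tT')); lia.
  + apply/noncrossingP => x y u v /(itvP _ _ _ (tib _ tT)) + /(itvP _ _ _ (tib _ tT)).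
    by move=> + + /T0P Tu _; case: Tu => ->; lia.
  + apply/noncrossingP => x y u v /(itvP _ _ _ (tib _ tT)) + /(itvP _ _ _ (tib _ tT)).
    by move=> + + /(itvP _ _ _ (tai _ tT')); lia.
  + by apply: nc2' neqT.
- apply/setP => T; rewrite !inE; case: eqVneq => [->|_] /=.
    by rewrite (negbTE T0b) (contraNF (@tai _)).
  case tT1: (T \in tau1); first by rewrite tai.
  case tT2: (T \in tau2) => //=.
  apply/negP => sT; suff /(card_itv3 (t32 _ tT2)) : T \subset itv i i by lia.
  apply/itvP => x Tx; have /itvP/(_ x Tx) := tib _ tT2; have /itvP/(_ x Tx) := sT; lia.
- apply/setP => T; rewrite !inE; case: eqVneq => [->|_] /=.
    by rewrite (negbTE T0a) (contraNF (@tib _)).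
  case tT2: (T \in tau2); first by rewrite orbT tib.
  case tT1: (T \in tau1) => //=.
  apply/negP => sT; suff /(card_itv3 (t31 _ tT1)) : T \subset itv i i by lia.
  apply/itvP => x Tx; have /itvP/(_ x Tx) := tai _ tT1; have /itvP/(_ x Tx) := sT; lia.
Qed.

End NoncrossingTriangles.

(** * Checkerboard colourings and their behaviour under gluing *)

Section Colouring.
Local Open Scope nat_scope.
Variable N : nat.
Implicit Types (a b i : 'I_N) (e T : {set 'I_N}) (tau B : {set {set 'I_N}}).

(** The marked edge is a parameter [e], so that the notion also applies to the two subpolygons
    beside the marked triangle. *)
Definition checkerboard e tau B : bool :=
  [&& B \subset tau,
      [forall T in tau, (e \subset T) ==> (T \in B)]
    & [forall T in tau, forall T' in tau,
        (#|T :&: T'| == 2) ==> ((T \in B) != (T' \in B))]].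

Lemma checkerboardP e tau B :
  reflect [/\ B \subset tau,
              forall T, T \in tau -> e \subset T -> T \in B
            & forall T T', T \in tau -> T' \in tau -> #|T :&: T'| = 2 ->
                (T \in B) != (T' \in B)]
          (checkerboard e tau B).
Proof.
apply: (iffP and3P) => [[sB /forall_inP he /forall_inP adj]|[sB he adj]].
  split=> // [T /he/implyP//|T T' /adj/forall_inP h /h /implyP h' /eqP]; exact: h'.
split=> //; apply/forall_inP => T tT; first by apply/implyP/he.
by apply/forall_inP => T' tT'; apply/implyP => /eqP; apply: adj.
Qed.

Section Glue.
Variables (a i b : 'I_N) (tau1 tau2 : {set {set 'I_N}}).
Hypotheses (lt_ai : a < i) (lt_ib : i < b).
Hypotheses (tri1 : triangulation a i tau1) (tri2 : triangulation i b tau2).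
Let T0 := [set a; i; b].
Let tau := glue a i b tau1 tau2.

Let t31 T : T \in tau1 -> #|T| = 3.
Proof. by case/andP: tri1 => _ /noncrossing_familyP[t3 _ _]; apply: t3. Qed.

Let t32 T : T \in tau2 -> #|T| = 3.
Proof. by case/andP: tri2 => _ /noncrossing_familyP[t3 _ _]; apply: t3. Qed.

Let sub1 T x : T \in tau1 -> x \in T -> a <= x <= i.
Proof.
by case/andP: tri1 => _ /noncrossing_familyP[_ sT _] /sT/itvP; apply.
Qed.

Let sub2 T x : T \in tau2 -> x \in T -> i <= x <= b.
Proof.
by case/andP: tri2 => _ /noncrossing_familyP[_ sT _] /sT/itvP; apply.
Qed.

Lemma glue_T0_notin1 : [set a; i; b] \notin tau1.
Proof.
apply/negP => tT; have := @sub1 _ b tT; rewrite !inE eqxx orbT => /(_ isT); lia.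
Qed.

Lemma glue_T0_notin2 : [set a; i; b] \notin tau2.
Proof.
apply/negP => tT; have := @sub2 _ a tT; rewrite !inE eqxx => /(_ isT); lia.
Qed.

Lemma glue_disjoint : [disjoint tau1 & tau2].
Proof.
apply/pred0P => T /=; apply/negP => /andP[tT1 tT2].
suff /(card_itv3 (t31 tT1)) : T \subset itv i i by lia.
by apply/itvP => x Tx; have := sub1 tT1 Tx; have := sub2 tT2 Tx; lia.
Qed.

Let capT0 x y : x != y -> [set x; y] \subset T0 ->
  forall T, #|T0 :&: T| = 2 -> T0 :&: T \subset [set x; y] -> [set y; x] \subset T.
Proof.
move=> xy _ T cT sT; rewrite setUC; have /eqP <- : T0 :&: T == [set x; y].
  by rewrite eqEcard sT cT cards2 xy.
exact: subsetIr.
Qed.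

(** The marked triangle is black, so its neighbours across the sides ai and ib are white. After
    complementation each part is coloured with that side as its marked edge. Triangles of different
    parts share at most the vertex [i] and impose no condition on each other. *)
Lemma checkerboard_glue B : checkerboard [set b; a] tau B =
  [&& B \subset tau, T0 \in B, checkerboard [set i; a] tau1 (tau1 :\: B)
    & checkerboard [set b; i] tau2 (tau2 :\: B)].
Proof.
have tau_T0 : T0 \in tau by rewrite !inE eqxx.
have tau_1 T : T \in tau1 -> T \in tau by rewrite !inE => ->; rewrite orbT.
have tau_2 T : T \in tau2 -> T \in tau by rewrite !inE => ->; rewrite !orbT.
have ne_ai : a != i by rewrite -val_eqE /=; lia.
have ne_ib : i != b by rewrite -val_eqE /=; lia.
have ne_ab : a != b by rewrite -val_eqE /=; lia.
have cap1 T : T \in tau1 -> T0 :&: T \subset [set a; i].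
  move=> tT; apply/subsetP => x; rewrite !inE => /andP[/orP[//|/eqP->] /(sub1 tT)]; lia.
have cap2 T : T \in tau2 -> T0 :&: T \subset [set i; b].
  move=> tT; apply/subsetP => x; rewrite !inE -orbA.
  by move=> /andP[/orP[/eqP->|//] /(sub2 tT)]; lia.
have cap12 T T' : T \in tau1 -> T' \in tau2 -> #|T :&: T'| <= 1.
  move=> tT tT'; rewrite -(cards1 i); apply/subset_leq_card/subsetP => x.
  rewrite !inE -val_eqE => /andP[/(sub1 tT) + /(sub2 tT')] /=; lia.
have edge1 T : T \in tau1 -> (#|T0 :&: T| == 2) = ([set i; a] \subset T).
  move=> tT; apply/idP/idP => [/eqP cT|]; last first.
    rewrite subUset !sub1set => /andP[Ti Ta].
    rewrite (_ : T0 :&: T = [set a; i]) ?cards2 ?ne_ai //.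
    by apply/eqP; rewrite eqEsubset cap1 // subUset !sub1set !inE Ti Ta !eqxx orbT.
  by apply: capT0 cT (cap1 _ tT); rewrite // subUset !sub1set !inE !eqxx ?orbT.
have edge2 T : T \in tau2 -> (#|T0 :&: T| == 2) = ([set b; i] \subset T).
  move=> tT; apply/idP/idP => [/eqP cT|]; last first.
    rewrite subUset !sub1set => /andP[Tb Ti].
    rewrite (_ : T0 :&: T = [set i; b]) ?cards2 ?ne_ib //.
    by apply/eqP; rewrite eqEsubset cap2 // subUset !sub1set !inE Ti Tb !eqxx !orbT.
  by apply: capT0 cT (cap2 _ tT); rewrite // subUset !sub1set !inE !eqxx ?orbT.
apply/checkerboardP/and4P => [[sB he adj]|[sB BT0 /checkerboardP[_ he1 adj1] /checkerboardP[_ he2 adj2]]].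
  have BT0 : T0 \in B by apply: he; rewrite // subUset !sub1set !inE !eqxx ?orbT.
  split=> //; apply/checkerboardP; split; rewrite ?subsetDl //.
  - move=> T tT eT; rewrite inE tT andbT.
    by have := adj _ _ tau_T0 (tau_1 _ tT); rewrite BT0 => /(_ (eqP _)) ->; rewrite ?edge1.
  - move=> T T' tT tT' /(adj _ _ (tau_1 _ tT) (tau_1 _ tT')).
    by rewrite !inE tT tT'; case: (_ \in B); case: (_ \in B).
  - move=> T tT eT; rewrite inE tT andbT.
    by have := adj _ _ tau_T0 (tau_2 _ tT); rewrite BT0 => /(_ (eqP _)) ->; rewrite ?edge2.
  - move=> T T' tT tT' /(adj _ _ (tau_2 _ tT) (tau_2 _ tT')).
    by rewrite !inE tT tT'; case: (_ \in B); case: (_ \in B).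
have notB1 T : T \in tau1 -> #|T0 :&: T| = 2 -> T \notin B.
  by move=> tT /eqP; rewrite edge1 // => /(he1 _ tT); rewrite inE => /andP[].
have notB2 T : T \in tau2 -> #|T0 :&: T| = 2 -> T \notin B.
  by move=> tT /eqP; rewrite edge2 // => /(he2 _ tT); rewrite inE => /andP[].
split=> // [T|T T'].
  rewrite {1}/tau !inE subUset !sub1set => /orP[/eqP-> //|/orP[tT|tT]] /andP[Tb Ta].
    by have /andP[_] := sub1 tT Tb; rewrite leqNgt lt_ib.
  by have /andP[+ _] := sub2 tT Ta; rewrite leqNgt lt_ai.
rewrite {1 2}/tau !inE.
move=> /orP[/eqP->|/orP[tT|tT]] /orP[/eqP->|/orP[tT'|tT']].
- by rewrite setIid card_set3.
- by rewrite BT0 => /(notB1 _ tT') /negbTE ->.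
- by rewrite BT0 => /(notB2 _ tT') /negbTE ->.
- by rewrite BT0 setIC => /(notB1 _ tT) /negbTE ->.
- by move=> /(adj1 _ _ tT tT'); rewrite !inE tT tT'; case: (_ \in B); case: (_ \in B).
- by have := cap12 _ _ tT tT' => + e; rewrite e.
- by rewrite BT0 setIC => /(notB2 _ tT) /negbTE ->.
- by have := cap12 _ _ tT' tT => + e; rewrite setIC e.
- by move=> /(adj2 _ _ tT tT'); rewrite !inE tT tT'; case: (_ \in B); case: (_ \in B).
Qed.

Lemma checkerboard_glue_unique B1 B2 :
    (forall B, checkerboard [set i; a] tau1 B = (B == B1)) ->
    (forall B, checkerboard [set b; i] tau2 B = (B == B2)) ->
  forall B, checkerboard [set b; a] tau B =
    (B == T0 |: ((tau1 :\: B1) :|: (tau2 :\: B2))).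
Proof.
move=> hB1 hB2 B; rewrite checkerboard_glue hB1 hB2.
have /checkerboardP[/subsetP sB1 _ _] : checkerboard [set i; a] tau1 B1 by rewrite hB1.
have /checkerboardP[/subsetP sB2 _ _] : checkerboard [set b; i] tau2 B2 by rewrite hB2.
have T01 := glue_T0_notin1; have T02 := glue_T0_notin2.
have disj T : T \in tau1 -> T \in tau2 = false by move=> tT; apply: (disjointFr glue_disjoint).
apply/and4P/eqP => [[/subsetP sB BT0 /eqP <- /eqP <-]|->].
  apply/setP => T; have := sB T; rewrite !inE /T0; case: eqVneq => [-> //|_] /=.
  by case: (T \in B); case: (T \in tau1); case: (T \in tau2) => //= /(_ isT).
split.
- apply/subsetP => T; rewrite !inE => /orP[->//|].
  by case/orP => /andP[_ ->]; rewrite ?orbT.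
- by rewrite !inE eqxx.
- apply/eqP/setP => T; rewrite !inE; have := sB1 T; have := disj T.
  case: eqVneq => [->|_] /=; first by rewrite (negbTE T01) => _; case: (_ \in B1) => // /(_ isT).
  case: (T \in tau1); case: (T \in tau2); case: (T \in B1) => //= d s;
    first [by rewrite ?andbF|by move: (d isT)|by move: (s isT)].
- apply/eqP/setP => T; rewrite !inE; have := sB2 T; have := disj T.
  case: eqVneq => [->|_] /=; first by rewrite (negbTE T02) => _; case: (_ \in B2) => // /(_ isT).
  case: (T \in tau1); case: (T \in tau2); case: (T \in B2) => //= d s;
    first [by rewrite ?andbF|by move: (d isT)|by move: (s isT)].
Qed.

End Glue.

(** Induction along the marked triangle: the colourings of the two parts exist, are unique, and
    determine that of the whole. *)
Lemma checkerboard_exists_unique a b tau : a < b -> triangulation a b tau ->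
  exists B0, forall B, checkerboard [set b; a] tau B = (B == B0).
Proof.
have [m] := ubnP (b - a); elim: m => // m IHm in a b tau *.
rewrite ltnS => le_m lt_ab tri.
have /andP[/eqP card_tau nc] := tri.
have [lt_ab1|ge_ab1] := ltnP a.+1 b; last first.
  have tau0 : tau = set0.
    by apply/eqP; rewrite -cards_eq0 card_tau -subn1; apply/eqP; lia.
  exists set0 => B; apply/checkerboardP/eqP => [[]|->].
    by rewrite tau0 subset0 => /eqP.
  by rewrite tau0; split=> [|T|T T']; rewrite ?subxx ?inE.
have [i [lt_ai lt_ib tT0]] := (card_noncrossing_family nc).2 card_tau lt_ab1.
have [tri1 tri2 ->] := triangulation_split lt_ai lt_ib tri tT0.
have [||B1 hB1] := IHm _ _ _ _ _ tri1; [lia|lia|].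
have [||B2 hB2] := IHm _ _ _ _ _ tri2; [lia|lia|].
by eexists; apply: (checkerboard_glue_unique lt_ai lt_ib tri1 tri2 hB1 hB2).
Qed.

Definition black_part e tau : {set {set 'I_N}} :=
  odflt set0 [pick B | checkerboard e tau B].

Lemma black_partE e tau B0 :
  (forall B, checkerboard e tau B = (B == B0)) -> black_part e tau = B0.
Proof.
move=> hB0; rewrite /black_part; case: pickP => [B|/(_ B0)]; rewrite hB0.
  by move/eqP.
by rewrite eqxx.
Qed.

Lemma black_partP a b tau : a < b -> triangulation a b tau ->
  forall B, checkerboard [set b; a] tau B = (B == black_part [set b; a] tau).
Proof.
by move=> lt_ab /(checkerboard_exists_unique lt_ab)[B0 hB0] B; rewrite (black_partE hB0).
Qed.

Definition imbalance a b tau : int :=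
  (#|black_part [set b; a] tau|%:Z - #|tau :\: black_part [set b; a] tau|%:Z)%R.

(** The 1 counts the black marked triangle; the signs change because both parts have their colours
    exchanged. *)
Lemma imbalance_glue a i b tau1 tau2 : a < i -> i < b ->
  triangulation a i tau1 -> triangulation i b tau2 ->
  imbalance a b (glue a i b tau1 tau2) =
    (1 - imbalance a i tau1 - imbalance i b tau2)%R.
Proof.
move=> lt_ai lt_ib tri1 tri2; rewrite /imbalance.
have hB1 := black_partP lt_ai tri1; have hB2 := black_partP lt_ib tri2.
rewrite (black_partE (checkerboard_glue_unique lt_ai lt_ib tri1 tri2 hB1 hB2)).
set B1 := black_part _ tau1; set B2 := black_part _ tau2.
have /checkerboardP[sB1 _ _] : checkerboard [set i; a] tau1 B1 by rewrite hB1.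
have /checkerboardP[sB2 _ _] : checkerboard [set b; i] tau2 B2 by rewrite hB2.
have T01 := glue_T0_notin1 lt_ai lt_ib tri1 tri2.
have T02 := glue_T0_notin2 lt_ai lt_ib tri1 tri2.
have disj := glue_disjoint lt_ai lt_ib tri1 tri2.
have -> : glue a i b tau1 tau2 :\:
    ([set a; i; b] |: (tau1 :\: B1 :|: tau2 :\: B2)) = B1 :|: B2.
  apply/setP => T; rewrite !inE; have := subsetP sB1 T; have := subsetP sB2 T.
  have : T \in tau1 -> T \in tau2 = false by apply: disjointFr.
  case: eqVneq => [->|_] /=.
    rewrite (negbTE T01) (negbTE T02) => _ s2 s1.
    by case: (_ \in B1) s1 => [/(_ isT)|_] //; case: (_ \in B2) s2 => [/(_ isT)|_].
  case: (T \in tau1); case: (T \in tau2); case: (T \in B1);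
    case: (T \in B2) => //= d s2 s1;
    first [by rewrite ?andbF|by move: (d isT)|by move: (s2 isT)|by move: (s1 isT)].
have dB : B1 :&: B2 = set0.
  by apply/eqP; rewrite setI_eq0; apply: disjointWl sB1 (disjointWr sB2 disj).
have dD : (tau1 :\: B1) :&: (tau2 :\: B2) = set0.
  by apply/eqP; rewrite setI_eq0; apply: disjointWl (subsetDl _ _) (disjointWr (subsetDl _ _) disj).
rewrite cardsU1 !cardsU dB dD !inE (negbTE T01) (negbTE T02) !andbF cards0 /=; lia.
Qed.

End Colouring.

(** * The recurrence for the weighted sum over triangulations, and its solution *)

Section WeightedSum.
Variables (N : nat) (K : fieldType).
Implicit Types (a b i : 'I_N) (s : K).

Definition weighted_sum s a b : K :=
  \sum_(tau | triangulation a b tau) s ^ imbalance a b tau.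

Lemma weighted_sum1 s a b : b = a.+1 :> nat -> weighted_sum s a b = 1.
Proof.
move=> b_eq; rewrite /weighted_sum (big_pred1 finset.set0) => [|tau].
  rewrite /imbalance set0D cards0 (_ : black_part _ _ = set0) ?cards0 ?subrr //.
  by apply: black_partE => B; apply/checkerboardP/eqP => [[/[!subset0]/eqP]|->];
    last by split=> [|T|T T']; rewrite ?subxx ?inE.
apply/andP/eqP => [[/eqP card_tau _]|->].
  by apply: cards0_eq; rewrite card_tau b_eq; lia.
split; first by rewrite cards0 b_eq; lia.
by apply/noncrossing_familyP; split=> [T|T|T T']; rewrite inE.
Qed.

(** Triangulations are sorted by the apex [i] of the triangle on the marked edge; splitting and
    gluing are inverse bijections, and [imbalance_glue] turns the weight into s times two weights in
    1/s. *)
Lemma weighted_sum_rec s a b : s != 0 -> (a.+1 < b)%N ->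
  weighted_sum s a b =
    s * \sum_(i : 'I_N | (a < i < b)%N) weighted_sum s^-1 a i * weighted_sum s^-1 i b.
Proof.
move=> s_neq0 lt_ab; rewrite /weighted_sum.
(* The inner sum has exactly one term: for i < j the sides ib of {a, i, b} and aj of {a, j, b} would
   cross. *)
transitivity (\sum_(tau | triangulation a b tau)
    \sum_(i : 'I_N | (a < i < b)%N && ([set a; i; b] \in tau)) s ^ imbalance a b tau).
  apply: eq_bigr => tau /andP[/eqP card_tau nc].
  have [i [lt_ai lt_ib tT0]] := (card_noncrossing_family nc).2 card_tau lt_ab.
  rewrite (big_pred1 i) // => j; apply/andP/eqP => [[/andP[lt_aj lt_jb] tTj]|->]; last first.
    by rewrite lt_ai lt_ib.
  have [_ _ ncT] := noncrossing_familyP _ _ _ nc.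
  apply/eqP; rewrite -val_eqE /=; apply/negPn/negP => neq_ij.
  have neqT : [set a; i; b] != [set a; j; b].
    apply/eqP => /setP/(_ i); rewrite !inE eqxx orbT -!val_eqE /=; lia.
  have [lt_ij|ge_ij] := ltnP i j.
    have /noncrossingP/(_ i b j a) := ncT _ _ tT0 tTj neqT.
    rewrite !inE !eqxx !orbT => /(_ isT isT isT isT); lia.
  have /noncrossingP/(_ a i j b) := ncT _ _ tT0 tTj neqT.
  rewrite !inE !eqxx !orbT => /(_ isT isT isT isT); lia.
rewrite (exchange_big_dep (fun i : 'I_N => (a < i < b)%N)) /=; last by move=> ? ? _ /andP[].
rewrite mulr_sumr; apply: eq_bigr => i /andP[lt_ai lt_ib].
rewrite (reindex_onto (fun p => glue a i b p.1 p.2)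
   (fun tau => (tau ::&: itv a i, tau ::&: itv i b))) /=; last first.
  move=> tau /andP[tri /andP[_ tT0]].
  by have [_ _ <-] := triangulation_split lt_ai lt_ib tri tT0.
rewrite big_distrlr /= pair_big_dep mulr_sumr /=.
apply: eq_big => [[tau1 tau2]|[tau1 tau2]] /=.
  rewrite lt_ai lt_ib /=; apply/andP/andP => [[/andP[tri tT0]]|[tri1 tri2]].
    rewrite xpair_eqE => /andP[/eqP e1 /eqP e2].
    by have := triangulation_split lt_ai lt_ib tri tT0; rewrite e1 e2 => -[].
  have [-> -> ->] := triangulation_glue lt_ai lt_ib tri1 tri2.
  by rewrite eqxx !inE eqxx.
move=> /andP[/andP[tri /andP[_ tT0]] /eqP[e1 e2]].
have := triangulation_split lt_ai lt_ib tri tT0; rewrite e1 e2 => -[tri1 tri2 _].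
rewrite imbalance_glue // !exprz_inv -expfzDr // -[X in X * _]expr1z -expfzDr //.
by congr (_ ^ _); rewrite addrA.
Qed.

Lemma weighted_sumE s a b : s != 0 -> (a < b)%N ->
  weighted_sum s a b = ghom s 1 0 (b - a).-1.
Proof.
have [m] := ubnP (b - a)%N; elim: m => // m IHm in s a b *.
rewrite ltnS => le_m s_neq0 lt_ab.
have [lt_ab1|ge_ab1] := ltnP a.+1 b; last first.
  have b_eq : b = a.+1 :> nat by lia.
  by rewrite weighted_sum1 // b_eq subSnn ghom0.
rewrite weighted_sum_rec //; set q := (b - a).-2.
have -> : (b - a).-1 = q.+1 by rewrite /q; lia.
rewrite ghom10S //; congr (_ * _).
pose F (i : nat) := ghom s 0 1 (i - a).-1 * ghom s 0 1 (b - i).-1.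
(* Inverting s exchanges y and z, hence W and V: reverse the summation and use [gcoefC]. *)
have ghomV n : ghom s^-1 1 0 n = ghom s 0 1 n.
  rewrite /ghom (reindex_inj rev_ord_inj); apply: eq_bigr => i _ /=.
  have le_in : (i <= n)%N by rewrite -ltnS.
  rewrite subSS subKn // gcoefC exprz_inv; congr (_ * _ ^ _); lia.
transitivity (\sum_(i < N | (a < i < b)%N) F i).
  apply: eq_bigr => i /andP[lt_ai lt_ib].
  by rewrite !IHm ?invr_eq0 // ?ghomV //; clear -lt_ai lt_ib le_m; lia.
transitivity (\sum_(a.+1 <= k < b) F k).
  rewrite big_geq_mkord (@big_ord_widen_cond _ _ _ b N (fun k => true && (a < k)%N)) //.
  exact: ltnW.
rewrite -{1}[(nat_of_ord a).+1]add0n big_addn (_ : (b - a.+1)%N = q.+1); last by rewrite /q; lia.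
rewrite big_mkord; apply: eq_bigr => i _; rewrite /F.
by congr (ghom _ _ _ _ * ghom _ _ _ _); rewrite /q; clear; lia.
Qed.

End WeightedSum.

(** * Orientation of triples of points in the plane *)

Section Orientation.
Variable R : realType.
Implicit Types (a b c p q u v x y z : 'rV[R]_2).

Lemma rV2_eq u v : u 0 0 = v 0 0 -> u 0 1 = v 0 1 -> u = v.
Proof.
move=> e0 e1; apply/rowP => -[[|[|//]] lt_j].
  by have -> : Ordinal lt_j = 0 by apply: val_inj.
by have -> : Ordinal lt_j = 1 by apply: val_inj.
Qed.

Lemma orient_cycle a b c : orient a b c = orient b c a.
Proof. by rewrite /orient; ring. Qed.

Lemma orient_swap a b c : orient b a c = - orient a b c.
Proof. by rewrite /orient; ring. Qed.

Lemma orientD a b p q (l m : R) : l + m = 1 ->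
  orient a b (l *: p + m *: q) = l * orient a b p + m * orient a b q.
Proof.
move=> e; have -> : l = 1 - m by rewrite -e addrK.
by rewrite /orient !mxE; ring.
Qed.

(* Grassmann-Pluecker *)
Lemma orient_trans u o a b c : 0 <= orient o u a -> 0 < orient o u b ->
  0 < orient o u c -> 0 < orient o a b -> 0 < orient o b c -> 0 < orient o a c.
Proof.
move=> ua ub uc ab bc; rewrite -(pmulr_rgt0 _ ub).
have -> : orient o u b * orient o a c =
    orient o u a * orient o b c + orient o u c * orient o a b.
  by rewrite /orient; ring.
by rewrite ltr_wpDl // ?mulr_ge0 ?mulr_gt0 // ltW.
Qed.

Lemma orient_sum (I : finType) (A : {set I}) (P : I -> 'rV[R]_2) (l : I -> R) a b :
  \sum_(i in A) l i = 1 ->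
  orient a b (\sum_(i in A) l i *: P i) = \sum_(i in A) l i * orient a b (P i).
Proof.
move=> l1; rewrite /orient !summxE.
pose c := (b 0 0 - a 0 0) * a 0 1 - (b 0 1 - a 0 1) * a 0 0.
transitivity (\sum_(i in A) ((b 0 0 - a 0 0) * (l i *: P i) 0 1 -
    (b 0 1 - a 0 1) * (l i *: P i) 0 0 - l i * c)); last first.
  by apply: eq_bigr => i _; rewrite !mxE /c; ring.
by rewrite !sumrB -!mulr_sumr -mulr_suml l1 /c; ring.
Qed.

Lemma orient_continuous a b : continuous (orient a b).
Proof.
move=> p; rewrite /orient.
have c i : ((fun q : 'rV[R]_2 => q 0 i) @ p --> p 0 i)%classic by apply: coord_continuous.
have c' k i : ((fun q : 'rV[R]_2 => q 0 i - k) @ p --> p 0 i - k)%classic.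
  by apply: cvgB (c i) (cvg_cst _).
have c'' l k i : ((fun q : 'rV[R]_2 => l * (q 0 i - k)) @ p --> l * (p 0 i - k))%classic.
  by apply: cvgM (cvg_cst _) (c' k i).
exact: cvgB (c'' _ _ _) (c'' _ _ _).
Qed.

(** From an interior point one can still move a little along the normal [d] of the line ab. This
    lowers the orientation by a positive amount and stays in [A], so the orientation was positive
    before the move. *)
Lemma interior_orient_gt0 a b p (A : set 'rV[R]_2) : a != b ->
  (forall q, A q -> 0 <= orient a b q) -> interior A p -> 0 < orient a b p.
Proof.
move=> neq_ab A_ge0 Ap.
pose d : 'rV[R]_2 := \row_j (if j == 0 then b 0 1 - a 0 1 else a 0 0 - b 0 0).
pose l := (b 0 0 - a 0 0) ^+ 2 + (b 0 1 - a 0 1) ^+ 2.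
have l_gt0 : 0 < l.
  rewrite lt0r addr_ge0 ?sqr_ge0 // andbT paddr_eq0 ?sqr_ge0 // !sqrf_eq0 !subr_eq0.
  apply: contra neq_ab => /andP[/eqP e0 /eqP e1].
  exact/eqP/esym/rV2_eq.
have ode e : orient a b (p + e *: d) = orient a b p - e * l.
  by rewrite /orient !mxE /= /l; ring.
have : ((fun e : R => p + e *: d) @ (0 : R) --> p + 0 *: d)%classic.
  apply: cvgD; first exact: cvg_cst.
  by apply: cvgZl; exact: cvg_id.
rewrite scale0r addr0 => /(_ _ Ap) /nbhs_ballP[e /= e_gt0 /(_ (e / 2))].
rewrite /ball /= sub0r normrN gtr0_norm ?divr_gt0 // => /(_ _) /A_ge0.
rewrite ode subr_ge0 => h; apply: lt_le_trans (h _).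
  by rewrite mulr_gt0 ?divr_gt0.
by rewrite gtr_pMr // invf_lt1 // ltr1n.
Qed.

(** The factor [orient x y z] makes the condition independent of the sense in which the triangle is
    listed. *)
Definition strictly_inside x y z p : Prop :=
  [/\ 0 < orient x y z * orient x y p, 0 < orient x y z * orient y z p
    & 0 < orient x y z * orient z x p].

Lemma affine_gt0 (A B : R) : 0 < A ->
  exists2 e0, 0 < e0 & forall e, 0 < e -> e <= e0 -> 0 < (1 - e) * A + e * B.
Proof.
move=> A_gt0; have den_gt0 : 0 < `|A - B| + 1 by rewrite ltr_wpDl.
(* The added 1 keeps the denominator nonzero and makes the final inequality strict. *)
exists (A / (`|A - B| + 1)); first exact: divr_gt0.
move=> e e_gt0; rewrite ler_pdivlMr // => le_e.
have -> : (1 - e) * A + e * B = A - e * (A - B) by ring.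
rewrite subr_gt0; apply: le_lt_trans (_ : e * `|A - B| < _).
  by rewrite ler_pM2l // ler_norm.
by apply: lt_le_trans le_e; rewrite ltr_pM2l // ltrDl.
Qed.

(** The point [q] is on the side xy and strictly inside the other two. The latter survives a short
    move, and moving towards [m] makes the first condition strict too. *)
Lemma strictly_inside_near x y z q m : orient x y q = 0 ->
    0 < orient x y z * orient x y m ->
    0 < orient x y z * orient y z q -> 0 < orient x y z * orient z x q ->
  exists2 e0, 0 < e0 & forall e, 0 < e -> e <= e0 ->
    strictly_inside x y z ((1 - e) *: q + e *: m).
Proof.
move=> xyq xym /(@affine_gt0 _ (orient x y z * orient y z m))[e1 e1_gt0 he1].
move=> /(@affine_gt0 _ (orient x y z * orient z x m))[e2 e2_gt0 he2].
exists (Num.min e1 e2) => [|e e_gt0]; first by rewrite lt_min e1_gt0.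
rewrite le_min => /andP[le1 le2].
have dist (k A B : R) : k * ((1 - e) * A + e * B) = (1 - e) * (k * A) + e * (k * B).
  by ring.
split; rewrite orientD ?subrK // dist; [|exact: he1|exact: he2].
by rewrite xyq !mulr0 add0r mulr_gt0.
Qed.

Lemma mul_lt0_side (c A B : R) : c != 0 -> A * B < 0 -> 0 < c * A \/ 0 < c * B.
Proof.
move=> c_neq0 AB; have [|le_cA] := ltP 0 (c * A); [by left|right].
have [//|le_cB] := ltP 0 (c * B).
have : 0 <= (c * A) * (c * B) by rewrite mulr_le0.
rewrite mulrACA -expr2 pmulr_rge0 ?lt0r ?sqr_ge0 ?sqrf_eq0 ?c_neq0 //.
by rewrite leNgt AB.
Qed.

(* Near the crossing point q of the segments [x, y] and [u, v], move towards the
   endpoint of [u, v] on the side of z and towards the endpoint of [x, y] on the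
   side of s. *)
Lemma crossing_overlap x y z u v s : orient x y z != 0 -> orient u v s != 0 ->
  orient x y u * orient x y v < 0 -> orient u v x * orient u v y < 0 ->
  exists p, strictly_inside x y z p /\ strictly_inside u v s p.
Proof.
move=> xyz uvs xyuv uvxy.
have convex_weight (A B : R) : A * B < 0 ->
    [/\ B - A != 0, 0 < B / (B - A) & 0 < - A / (B - A)].
  move=> AB; have neq : B - A != 0.
    by rewrite subr_eq0; apply: contraTneq AB => ->; rewrite -leNgt -expr2 sqr_ge0.
  have sq (c : R) : c / (B - A) = c * (B - A) / (B - A) ^+ 2 by field.
  have sq_gt0 : 0 < (B - A) ^+ 2 by rewrite lt0r sqrf_eq0 neq sqr_ge0.
  split; rewrite // sq divr_gt0 //.
    have -> : B * (B - A) = B ^+ 2 - A * B by ring.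
    by rewrite subr_gt0 (lt_le_trans AB) ?sqr_ge0.
  have -> : - A * (B - A) = A ^+ 2 - A * B by ring.
  by rewrite subr_gt0 (lt_le_trans AB) ?sqr_ge0.
have [neq1 l1 l2] := convex_weight _ _ uvxy.
have [neq2 m1 m2] := convex_weight _ _ xyuv.
move: l1 l2 m1 m2; set l1 := _ / _; set l2 := _ / _; set m1 := _ / _; set m2 := _ / _.
move=> l1_gt0 l2_gt0 m1_gt0 m2_gt0.
pose q := l1 *: x + l2 *: y.
have l12 : l1 + l2 = 1 by rewrite /l1 /l2; field.
have m12 : m1 + m2 = 1 by rewrite /m1 /m2; field.
have qE : q = m1 *: u + m2 *: v.
  have eC : orient x y v - orient x y u = - (orient u v y - orient u v x).
    by rewrite /orient; ring.
  have coordE j : orient u v y * x 0 j - orient u v x * y 0 j =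
      - (orient x y v * u 0 j - orient x y u * v 0 j) -> q 0 j = (m1 *: u + m2 *: v) 0 j.
    rewrite !mxE /l1 /l2 /m1 /m2 eC => e; set C := _ - _ in neq1 *.
    apply: (mulfI neq1); rewrite -/C.
    transitivity (orient u v y * x 0 j - orient u v x * y 0 j); first by field.
    by rewrite e; field.
  by apply: rV2_eq; apply: coordE; rewrite /orient; ring.
have degen a b : orient a b a = 0 /\ orient a b b = 0 by split; rewrite /orient; ring.
have sq_gt0 (c : R) : c != 0 -> 0 < c * c by move=> c0; rewrite -expr2 lt0r sqrf_eq0 c0 sqr_ge0.
have inside a b c (l m : R) : l + m = 1 -> 0 < l -> 0 < m -> orient a b c != 0 ->
  [/\ orient a b (l *: a + m *: b) = 0,
     0 < orient a b c * orient b c (l *: a + m *: b) &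
     0 < orient a b c * orient c a (l *: a + m *: b)].
  move=> lm l0 m0 abc; rewrite !orientD // !(degen _ _).1 !(degen _ _).2.
  rewrite -(orient_cycle a) [orient c a b]orient_cycle !mulr0 addr0 add0r addr0.
  by split=> //; rewrite mulrCA; apply: mulr_gt0 => //; apply: sq_gt0.
have [q1 q2 q3] := inside x y z l1 l2 l12 l1_gt0 l2_gt0 xyz.
have [] := inside u v s m1 m2 m12 m1_gt0 m2_gt0 uvs.
rewrite -qE -/q in q1 q2 q3 * => q4 q5 q6.
have [a [auv sa]] : exists a, orient u v a = 0 /\ 0 < orient x y z * orient x y a.
  have [h|h] := mul_lt0_side xyz xyuv; [exists u|exists v]; split=> //;
    [exact: (degen _ _).1|exact: (degen _ _).2].
have [b [bxy sb]] : exists b, orient x y b = 0 /\ 0 < orient u v s * orient u v b.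
  have [h|h] := mul_lt0_side uvs uvxy; [exists x|exists y]; split=> //;
    [exact: (degen _ _).1|exact: (degen _ _).2].
have half : 2^-1 + 2^-1 = 1 :> R by field.
have h_gt0 : 0 < 2^-1 :> R by rewrite invr_gt0 ltr0n.
(* One target serves both triangles: [b] is on the line xy and [a] on the line uv, so each line sees
   only the contribution of the other point, which has the right sign. *)
pose m := 2^-1 *: a + 2^-1 *: b.
have [|e1 e1_gt0 he1] := @strictly_inside_near x y z q m q1 _ q2 q3.
  by rewrite orientD // bxy mulr0 addr0 mulrCA mulr_gt0.
have [|e2 e2_gt0 he2] := @strictly_inside_near u v s q m q4 _ q5 q6.
  by rewrite orientD // auv mulr0 add0r mulrCA mulr_gt0.
have e_gt0 : 0 < Num.min e1 e2 by rewrite lt_min e1_gt0.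
by eexists; split; [apply: (he1 _ e_gt0)|apply: (he2 _ e_gt0)]; rewrite ge_min lexx ?orbT.
Qed.

End Orientation.

(** * A separating side for two non-crossing triangles *)

Section Separation.
Local Open Scope nat_scope.
Variable N : nat.
Implicit Types (x y z : 'I_N) (T : {set 'I_N}).

Lemma set3_third x y T : #|T| = 3 -> x \in T -> y \in T -> x != y ->
  exists z, [/\ z != x, z != y & T = [set x; y; z]].
Proof.
move=> T3 Tx Ty neq_xy.
have Dy : y \in T :\ x by rewrite !inE eq_sym neq_xy.
have /eqP/cards1P[z ez] : #|T :\ x :\ y| = 1.
  by move: T3; rewrite (cardsD1 x) Tx (cardsD1 y (T :\ x)) Dy => -[].
exists z; have : z \in T :\ x :\ y by rewrite ez inE.
rewrite !inE => /and3P[zy zx _]; split=> //.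
by rewrite -setUA -ez (setD1K Dy) setD1K.
Qed.

(** Let x < y < z be the vertices of [T]. The side xz separates if [T'] has no vertex strictly
    between x and z, and xy or yz does if it encloses [T']. In the remaining case the vertices of
    [T'] can only be x, y, z. *)
Lemma noncrossing_separated T T' : noncrossing T T' -> T != T' ->
    #|T| = 3%N -> #|T'| = 3%N ->
  exists x y, [/\ x \in T, y \in T, x < y
    & (forall t, t \in T -> x <= t <= y) /\ (forall t, t \in T' -> ~~ (x < t < y)) \/
      (forall t, t \in T -> ~~ (x < t < y)) /\ (forall t, t \in T' -> x <= t <= y)].
Proof.
move=> /noncrossingP nc neqT T3 T'3; have [x [y [z [xy yz eT]]]] := card3_sorted T3.
have [Tx Ty Tz] : [/\ x \in T, y \in T & z \in T] by rewrite eT !inE !eqxx !orbT.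
have TP t : t \in T -> [\/ t = x :> nat, t = y :> nat | t = z :> nat].
  by rewrite eT !inE => /orP[/orP[]|] /eqP->; [constructor 1|constructor 2|constructor 3].
have side u v : u \in T -> v \in T ->
    (forall t, t \in T' -> ~~ (u < t < v)) \/ (forall t, t \in T' -> u <= t <= v).
  move=> Tu Tv; case: (boolP [exists t in T', u < t < v]) => [|/exists_inPn]; last by left.
  by move=> /exists_inP[t T't utv]; right=> t' T't'; apply: (nc u v t t').
have [nxz|xz] := side x z Tx Tz.
  exists x, z; split=> //; first exact: ltn_trans yz.
  by left; split=> // t /TP[]->; clear -xy yz; lia.
have [nxy|?] := side x y Tx Ty; last first.
  by exists x, y; split=> //; right; split=> // t /TP[]->; clear -xy yz; lia.
have [nyz|?] := side y z Ty Tz; last first.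
  by exists y, z; split=> //; right; split=> // t /TP[]->; clear -xy yz; lia.
case/negP: neqT; rewrite eq_sym eqEcard T3 T'3 andbT; apply/subsetP => t T't.
have := xz t T't; have := nxy t T't; have := nyz t T't.
rewrite eT !inE -!val_eqE /=; clear; lia.
Qed.

End Separation.

(** * Hulls of vertex sets of a strictly convex polygon *)

Section Polygon.
Variables (R : realType) (m : nat) (P : 'I_m -> 'rV[R]_2).
Implicit Types (i j k x y z u v : 'I_m) (p : 'rV[R]_2) (A B T : {set 'I_m}).
Implicit Types tau : {set {set 'I_m}}.

Lemma hull_orient_ge0 A (a b : 'rV[R]_2) p : hull P A p ->
  (forall i, i \in A -> 0 <= orient a b (P i)) -> 0 <= orient a b p.
Proof.
move=> [l [l_ge0 l1 ->]] A_ge0; rewrite orient_sum //.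
by apply: sumr_ge0 => i iA; rewrite mulr_ge0 ?A_ge0.
Qed.

Lemma hull_subset A B : A \subset B -> (hull P A `<=` hull P B)%classic.
Proof.
move=> /subsetP sAB p [l [l_ge0 l1 ->]].
exists (fun i => if i \in A then l i else 0); split=> [i||].
- by case: ifP.
- rewrite -l1 [RHS]big_mkcond [LHS]big_mkcond /=; apply: eq_bigr => i _.
  by case: (boolP (i \in A)) => [/sAB->|_] //; rewrite if_same.
- rewrite [LHS]big_mkcond [RHS]big_mkcond /=; apply: eq_bigr => i _.
  by case: (boolP (i \in A)) => [/sAB->|_] //; rewrite scale0r if_same.
Qed.

(** The barycentric coordinates of [p] are its orientations against the three sides divided by [s];
    they are written over the square of [s] to show their sign. *)
Lemma hull_triangle x y z p : let s := orient (P x) (P y) (P z) in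
    s != 0 -> 0 <= s * orient (P x) (P y) p -> 0 <= s * orient (P y) (P z) p ->
    0 <= s * orient (P z) (P x) p ->
  hull P [set x; y; z] p.
Proof.
move=> s s_neq0 pz px py.
have xy : x != y by apply: contraNneq s_neq0 => e; rewrite /s /orient e; apply/eqP; ring.
have xz : x != z by apply: contraNneq s_neq0 => e; rewrite /s /orient e; apply/eqP; ring.
have yz : y != z by apply: contraNneq s_neq0 => e; rewrite /s /orient e; apply/eqP; ring.
pose l i := (if i == x then s * orient (P y) (P z) p
  else if i == y then s * orient (P z) (P x) p
  else s * orient (P x) (P y) p) / s ^+ 2.
have sum3 (V : nmodType) (F : 'I_m -> V) :
    \sum_(i in [set x; y; z]) F i = F x + (F y + F z).
  by rewrite -setUA big_setU1 ?big_setU1 ?big_set1 ?inE // negb_or xy.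
have [lx ly lz] : [/\ l x = orient (P y) (P z) p / s, l y = orient (P z) (P x) p / s
    & l z = orient (P x) (P y) p / s].
  rewrite /l !eqxx (eq_sym y x) (eq_sym z x) (eq_sym z y).
  rewrite (negbTE xy) (negbTE xz) (negbTE yz).
  by split; field.
exists l; split=> [i||].
- by rewrite /l divr_ge0 ?sqr_ge0 //; case: ifP => // _; case: ifP.
- by rewrite sum3 lx ly lz; rewrite /s /orient in s_neq0 *; field.
- rewrite sum3 lx ly lz; apply: rV2_eq; rewrite !mxE.
    by rewrite /s /orient in s_neq0 *; field.
  by rewrite /s /orient in s_neq0 *; field.
Qed.

Lemma interior_triangle x y z p : strictly_inside (P x) (P y) (P z) p ->
  interior (hull P [set x; y; z]) p.
Proof.
move=> [pz px py].
have s_neq0 : orient (P x) (P y) (P z) != 0.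
  by apply: contraTneq pz => ->; rewrite mul0r ltxx.
have near_gt0 (a b : 'rV[R]_2) (s : R) : 0 < s * orient a b p ->
    \forall q \near p, 0 < s * orient a b q.
  have cv : ((fun q => s * orient a b q) @ p --> s * orient a b p)%classic.
    exact: cvgM (cvg_cst _) (@orient_continuous _ a b p).
  by move=> gt0; apply: (cvgr_gt _ cv).
rewrite /interior /=; near=> q; apply: hull_triangle => //; apply: ltW; near: q;
  exact: near_gt0.
Unshelve. all: by end_near. Qed.

Hypothesis hP : strictly_convex P.

Lemma edge_orient j j' i : j' = j.+1 :> nat -> i != j -> i != j' ->
  0 < orient (P j) (P j') (P i).
Proof.
move=> ej' ij ij'; have ordSj : ordS j = j'.
  by apply: val_inj; rewrite /= -ej' modn_small.
by rewrite -ordSj; apply: hP; rewrite ?ordSj.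
Qed.

(** Induction on k - j, since convexity is given only along boundary edges. Around the pivot [P i],
    the triples (i, j, k-1) and (i, k-1, k) combine by [orient_trans], the edge from i to i + 1
    keeping all points in one half-plane. *)
Lemma convex_orient i j k : (i < j)%N -> (j < k)%N ->
  0 < orient (P i) (P j) (P k).
Proof.
move=> ij; have [d] := ubnP (k - j)%N; elim: d => // d IHd in k *.
rewrite ltnS => le_d jk.
have [kj|kj] := eqVneq (k : nat) j.+1.
  by rewrite orient_cycle; apply: edge_orient; rewrite // -val_eqE /=; lia.
have lt_i' : (i.+1 < m)%N by apply: leq_trans (ltn_ord j); lia.
have lt_k' : (k.-1 < m)%N by apply: leq_ltn_trans (ltn_ord k); lia.
pose i' := Ordinal lt_i'; pose k' := Ordinal lt_k'.
apply: (@orient_trans R (P i') (P i) (P j) (P k') (P k)).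
- have [<-|neq] := eqVneq i' j; first by rewrite le_eqVlt /orient; apply/orP; left; apply/eqP; ring.
  move: neq; rewrite -val_eqE /= => neq.
  by apply/ltW/edge_orient; rewrite // -val_eqE /=; lia.
- by apply: edge_orient; rewrite // -val_eqE /=; lia.
- by apply: edge_orient; rewrite // -val_eqE /=; lia.
- by apply: IHd => /=; lia.
- by rewrite orient_cycle; apply: edge_orient; rewrite // -?val_eqE /=; lia.
Qed.

Lemma orient_outside x y i : (x < y)%N -> ~~ (x < i < y)%N ->
  0 <= orient (P x) (P y) (P i).
Proof.
move=> xy nxiy; have [->|ix] := eqVneq i x; first by rewrite /orient; nra.
have [->|iy] := eqVneq i y; first by rewrite /orient; nra.
move: ix iy; rewrite -!val_eqE /= => ix iy.
have [lt_ix|ge_ix] := ltnP i x.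
  by rewrite -orient_cycle ltW // convex_orient.
by rewrite ltW // convex_orient //; lia.
Qed.

Lemma orient_inside x y i : (x <= i <= y)%N -> 0 <= orient (P y) (P x) (P i).
Proof.
move=> xiy; have [->|ix] := eqVneq i x; first by rewrite /orient; nra.
have [->|iy] := eqVneq i y; first by rewrite /orient; nra.
move: ix iy; rewrite -!val_eqE /= => ix iy.
by rewrite orient_cycle ltW // convex_orient; lia.
Qed.

Lemma orient_neq0 x y z : x != y -> y != z -> z != x ->
  orient (P x) (P y) (P z) != 0.
Proof.
rewrite -!val_eqE /= => xy yz zx.
have gt0 i j k : (i < j)%N -> (j < k)%N -> orient (P i) (P j) (P k) != 0.
  by move=> ij jk; rewrite gt_eqF // convex_orient.
case: (ltngtP x y) xy => // xy _; case: (ltngtP y z) yz => // yz _;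
  case: (ltngtP z x) zx => // zx _; try lia.
- exact: gt0.
- by rewrite -orient_cycle gt0.
- by rewrite orient_cycle orient_swap oppr_eq0 -orient_cycle gt0.
- by rewrite orient_cycle gt0.
- by rewrite orient_swap oppr_eq0 gt0.
- by rewrite orient_cycle orient_swap oppr_eq0 gt0.
Qed.

Lemma crossing_interiors T T' x y u v : #|T| = 3%N -> #|T'| = 3%N ->
    x \in T -> y \in T -> u \in T' -> v \in T' -> (x < u < y)%N -> ~~ (x <= v <= y)%N ->
  exists p, interior (hull P T) p /\ interior (hull P T') p.
Proof.
move=> T3 T'3 Tx Ty T'u T'v xuy xvy.
have xy : x != y by rewrite -val_eqE /=; clear -xuy; lia.
have uv : u != v by rewrite -val_eqE /=; clear -xuy xvy; lia.
have [z [zx zy ->]] := set3_third T3 Tx Ty xy.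
have [s [su sv ->]] := set3_third T'3 T'u T'v uv.
have [||||p [Tp T'p]] := @crossing_overlap R (P x) (P y) (P z) (P u) (P v) (P s).
- by apply: orient_neq0; rewrite // eq_sym.
- by apply: orient_neq0; rewrite // eq_sym.
- have /andP[lt_xu lt_uy] := xuy.
  rewrite nmulr_rlt0; last by rewrite orient_cycle orient_swap oppr_lt0 -orient_cycle convex_orient.
  have [lt_vx|ge_vx] := ltnP v x.
    by rewrite -orient_cycle convex_orient //; clear -xuy; lia.
  by rewrite convex_orient //; clear -xuy xvy ge_vx; lia.
- have /andP[lt_xu lt_uy] := xuy.
  have [lt_vx|ge_vx] := ltnP v x.
    rewrite pmulr_rlt0; last by rewrite orient_cycle convex_orient //.
    by rewrite orient_swap oppr_lt0 convex_orient //; clear -xuy lt_vx; lia.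
  rewrite pmulr_rlt0; last first.
    by rewrite -orient_cycle convex_orient //; clear -xuy xvy ge_vx; lia.
  rewrite orient_cycle orient_swap oppr_lt0 -orient_cycle convex_orient //.
  by clear -xuy xvy ge_vx; lia.
by exists p; split; apply: interior_triangle.
Qed.

(** The line through the separating side puts the two interiors into opposite open half-planes. *)
Lemma noncrossing_interiors T T' : noncrossing T T' -> T != T' ->
    #|T| = 3%N -> #|T'| = 3%N ->
  (interior (hull P T) `&` interior (hull P T') = classical_sets.set0)%classic.
Proof.
move=> nc neqT T3 T'3; apply/seteqP; split=> // p [Tp T'p].
have [x [y [Tx Ty lt_xy sep]]] := noncrossing_separated nc neqT T3 T'3.
have neq_xy : x != y by rewrite -val_eqE /=; clear -lt_xy; lia.
have [z [zx zy _]] := set3_third T3 Tx Ty neq_xy.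
have neqP : P x != P y.
  apply: contraTneq isT => e; have : orient (P x) (P y) (P z) == 0.
    by rewrite e /orient; apply/eqP; ring.
  by rewrite (negbTE (orient_neq0 _ _ _)) // eq_sym.
have opp A B : (forall t, t \in A -> (x <= t <= y)%N) ->
    (forall t, t \in B -> ~~ (x < t < y)%N) ->
    interior (hull P A) p -> interior (hull P B) p -> False.
  move=> Axy Bxy Ap Bp.
  have : 0 < orient (P y) (P x) p.
    apply: (interior_orient_gt0 _ _ Ap); first by rewrite eq_sym.
    by move=> q /hull_orient_ge0; apply=> t /Axy; apply: orient_inside.
  have : 0 < orient (P x) (P y) p.
    apply: (interior_orient_gt0 _ _ Bp) => // q /hull_orient_ge0; apply=> t /Bxy.
    exact: orient_outside.
  by rewrite orient_swap oppr_gt0 => /lt_trans h /h; rewrite ltxx.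
by case: sep => -[h1 h2]; [apply: (opp T T')|apply: (opp T' T)].
Qed.

(** Descent: a point of the subpolygon on a..b lies in the triangle {a, i, b}, or beyond its side ai
    or ib and then in the smaller subpolygon there. *)
Lemma triangulation_cover (a b : 'I_m) tau p : (a.+1 < b)%N -> triangulation a b tau ->
    (forall j k : 'I_m, (a <= j)%N -> (k <= b)%N -> k = j.+1 :> nat ->
       0 <= orient (P j) (P k) p) ->
    0 <= orient (P b) (P a) p ->
  exists2 T, T \in tau & hull P T p.
Proof.
have [d] := ubnP (b - a)%N; elim: d => // d IHd in a b tau *.
rewrite ltnS => le_d lt_ab tri edges ba.
have /andP[/eqP card_tau nc] := tri.
have [i [lt_ai lt_ib tT0]] := (card_noncrossing_family nc).2 card_tau lt_ab.
have [tri1 tri2 _] := triangulation_split lt_ai lt_ib tri tT0.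
have sub T c e : T \in tau ::&: itv c e -> T \in tau by rewrite inE => /andP[].
have [ai|] := ltP (orient (P a) (P i) p) 0.
  have [||||T tT Tp] := IHd a i _ _ _ tri1; last by exists T; rewrite ?(sub _ _ _ tT).
  - by clear -lt_ai lt_ib le_d; lia.
  (* For i = a + 1 the side ai is a boundary edge, and [p] cannot lie beyond it. *)
  - rewrite ltn_neqAle lt_ai andbT; apply: contraTneq ai => e.
    by rewrite -leNgt edges // ltnW.
  - by move=> j k aj ki; apply: edges => //; clear -ki lt_ib; lia.
  - by rewrite orient_swap oppr_ge0 ltW.
move=> ai; have [ib|] := ltP (orient (P i) (P b) p) 0.
  have [||||T tT Tp] := IHd i b _ _ _ tri2; last by exists T; rewrite ?(sub _ _ _ tT).
  - by clear -lt_ai lt_ib le_d; lia.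
  - rewrite ltn_neqAle lt_ib andbT; apply: contraTneq ib => e.
    by rewrite -leNgt edges // ltnW.
  - by move=> j k ij kb; apply: edges => //; clear -ij lt_ai; lia.
  - by rewrite orient_swap oppr_ge0 ltW.
move=> ib; exists [set a; i; b] => //.
have aib := convex_orient lt_ai lt_ib.
by apply: hull_triangle; rewrite ?gt_eqF ?mulr_ge0 // ltW.
Qed.

End Polygon.

(** * From geometric to combinatorial triangulations, and the conclusion *)

Lemma is_triangulationP (R : realType) n (P : 'I_n.+2 -> 'rV[R]_2)
    (tau : {set {set 'I_n.+2}}) : strictly_convex P -> (0 < n)%N ->
  is_triangulation P tau <-> triangulation ord0 ord_max tau.
Proof.
move=> hP n_gt0; split=> [[card_tau t3 disj _]|].
  apply/andP; split; first by rewrite card_tau subn0.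
  apply/noncrossing_familyP; split=> // [T tT|T T' tT tT' neqT].
    by apply/itvP => x _ /=; rewrite -ltnS.
  apply/noncrossingP => x y u v Tx Ty T'u T'v xuy; apply: contraT => xvy.
  have [p [Tp T'p]] := crossing_interiors hP (t3 _ tT) (t3 _ tT') Tx Ty T'u T'v xuy xvy.
  have : (interior (hull P T) `&` interior (hull P T'))%classic p by [].
  by rewrite disj.
move=> tri; have /andP[/eqP card_tau nc] := tri.
have [t3 _ ncT] := noncrossing_familyP _ _ _ nc.
split=> //.
- by move=> T T' tT tT' neqT; apply: noncrossing_interiors; rewrite ?t3 ?ncT.
apply/seteqP; split=> p.
  by move=> [T _]; apply: hull_subset; apply: subsetT.
move=> hp; have [|j k _ _ ek||T tT Tp] := @triangulation_cover _ _ _ hP _ _ tau p _ tri.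
- by rewrite /= ltnS.
- apply: (hull_orient_ge0 hp) => i _; apply: orient_outside => //; clear -ek; lia.
- by apply: (hull_orient_ge0 hp) => i _; apply: orient_inside => //=; rewrite -ltnS.
by exists T.
Qed.

Lemma w_ghom (R : realType) n (P : 'I_n.+2 -> 'rV[R]_2) :
  strictly_convex P -> w P = ghom t 1 0 n.
Proof.
move=> hP; rewrite /w; have [->|n_gt0] := posnP n; first by rewrite ghom0.
have t_neq0 : t != 0 by rewrite /t tofrac_eq0 polyX_eq0.
(* The summands agree by conversion, [marked_edge n] being the edge [[set ord_max; ord0]]; only the
   ranges of summation need an argument. *)
transitivity (weighted_sum t (ord0 : 'I_n.+2) ord_max); last exact: weighted_sumE.
by apply: eq_bigl => tau; apply/asboolP/idP => /(is_triangulationP _ hP n_gt0).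
Qed.

Theorem theorem2p5 (R : realType) (P : forall n : nat, 'I_n.+2 -> 'rV[R]_2)
    (hP : forall n : nat, strictly_convex (P n)) (n : nat) :
  [/\ w (P (3 * n)%N) =
        \sum_(0 <= k < n.+1)
          'C(4 * n - 2 * k, n + k)%:R * 'C(2 * n + 2 * k, 3 * k)%:R *
          (t ^ (n%:Z - (2 * k)%N%:Z) / (3 * k + 1)%N%:R),
      w (P (3 * n + 1)%N) =
        \sum_(0 <= k < n.+1)
          'C(4 * n + 2 - 2 * k, n + k)%:R * 'C(2 * n + 2 * k, 3 * k)%:R *
          (t ^ ((n + 1)%N%:Z - (2 * k)%N%:Z) / (2 * n + 1 - k)%N%:R)
    & w (P (3 * n + 2)%N) =
        \sum_(0 <= k < n.+1)
          'C(4 * n + 2 - 2 * k, n + 1 + k)%:R *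
          'C(2 * n + 2 + 2 * k, 3 * k + 1)%:R *
          (t ^ (n%:Z - (2 * k)%N%:Z) / (3 * k + 2)%N%:R)].
Proof.
have t_neq0 : t != 0 by rewrite /t tofrac_eq0 polyX_eq0.
have natr_neq0 k : k.+1%:R != 0 :> ratfun.
  by rewrite -(rmorph_nat (@tofrac {poly rat})) tofrac_eq0 -polyC_natr polyC_eq0 pnatr_eq0.
rewrite !w_ghom //.
by split; [exact: ghom10_mod0|exact: ghom10_mod1|exact: ghom10_mod2].
Qed.
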